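(* Let $\Gamma$ be a set, $\lambda:\Gamma\to\Gamma$ a function, $K$ a non-trivial finite abelian group, and $\sigma_\lambda:K^\Gamma\to K^\Gamma$ the generalized shift, $\sigma_\lambda((x_i)_{i\in\Gamma})=(x_{\lambda(i)})_{i\in\Gamma}$. The following conditions are equivalent: (a) $\mathrm{ent}(\sigma_\lambda)=0$; (b) $\mathrm{ent}(\sigma_\lambda)$ is finite; (c) $\lambda$ is bounded; (d) $\sigma_\lambda$ is quasi-periodic; (e) $\sigma_\lambda$ is locally quasi-periodic.
   Context: $\mathbb N$ contains $0$. Algebraic entropy: for an abelian group $G$, an endomorphism $\phi:G\to G$, a finite subgroup $F$ of $G$ and a positive integer $n$, let $T_n(\phi,F)=F+\phi(F)+\ldots+\phi^{n-1}(F)$, $H(\phi,F)=\lim_{n\to\infty}\frac{\log|T_n(\phi,F)|}{n}$ (the limit exists), and $\mathrm{ent}(\phi)=\sup\{H(\phi,F):F\text{ a finite subgroup of }G\}\in[0,\infty]$. Bounded: $\lambda:\Gamma\to\Gamma$ defines a preorder on $\Gamma$ by $i\leq_\lambda j$ iff $\lambda^s(j)=i$ for some $s\in\mathbb N$. A subset $I\subseteq\Gamma$ is totally preordered if for all $i,j\in I$ either $i\leq_\lambda j$ or $j\leq_\lambda i$ (antisymmetry is not required). $\lambda$ is bounded if there exists $N\in\mathbb N$ such that $|I|\leq N$ for every totally preordered subset $I$ of $(\Gamma,\leq_\lambda)$. Quasi-periodicity: for a function $f:X\to X$, a point $x\in X$ is quasi-periodic if $f^{n}(x)=f^{m}(x)$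 for some $n<m$ in $\mathbb N$; $f$ is locally quasi-periodic if every point of $X$ is quasi-periodic; $f$ is quasi-periodic if there exist $n<m$ in $\mathbb N$ with $f^n=f^m$. *)

(* Defs.v *)
From HB Require Import structures.
From mathcomp Require Import all_boot all_order all_algebra finmap.
From mathcomp Require Import all_classical all_reals all_analysis.

Set Implicit Arguments.
Unset Strict Implicit.
Unset Printing Implicit Defensive.

Import Order.TTheory GRing.Theory Num.Theory.
Import numFieldNormedType.Exports.

Local Open Scope classical_set_scope.
Local Open Scope ring_scope.

Section Entropy.
Variables (G : zmodType) (phi : {additive G -> G}).

Definition set_sum (A B : set G) : set G := [set a + b | a in A & b in B].

Definition finite_subgroup (F : set G) : Prop :=
  finite_set F /\ GRing.zmod_closed (mem F).

Definition trajectory (F : set G) (n : nat) : set G :=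
  \big[set_sum/[set 0]]_(i < n) (iter i phi @` F).

(* [fset_set] is the finite set underlying a [set] only when the latter is
   finite, which holds for the trajectories of a finite [F]. The limit exists
   whenever [F] is a finite subgroup; the term of index 0 is irrelevant. *)
Definition entropy_wrt (R : realType) (F : set G) : R :=
  limn (fun n : nat => ln (#|` fset_set (trajectory F n)|%:R : R) / n%:R).

Definition ent (R : realType) : \bar R :=
  ereal_sup [set (entropy_wrt R F)%:E | F in finite_subgroup].

End Entropy.

Section GeneralizedShift.
Variables (Gamma : Type) (lambda : Gamma -> Gamma) (K : zmodType).

Definition gshift (x : Gamma -> K) : Gamma -> K := fun i => x (lambda i).

Lemma gshift_is_zmod_morphism : zmod_morphism gshift.
Proof. by []. Qed.

HB.instance Definition _ :=
  GRing.isZmodMorphism.Build (Gamma -> K) (Gamma -> K) gshift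
    gshift_is_zmod_morphism.

End GeneralizedShift.

Section Selfmaps.
Variables (X : Type) (f : X -> X).

Definition le_iter (i j : X) : Prop := exists s : nat, iter s f j = i.

Definition bounded_map : Prop :=
  exists N : nat, forall I : set X, total_on I le_iter -> (I #<= `I_N)%card.

Definition quasi_periodic_pt (x : X) : Prop :=
  exists n m : nat, (n < m)%N /\ iter n f x = iter m f x.

Definition locally_quasi_periodic : Prop := forall x : X, quasi_periodic_pt x.

Definition quasi_periodic : Prop :=
  exists n m : nat, (n < m)%N /\ iter n f = iter m f.

End Selfmaps.

(* Main.v *)
Require Import Defs.
From mathcomp Require Import all_boot all_order all_algebra finmap zify.
From mathcomp Require Import all_classical all_reals all_analysis.

(* If lambda is unbounded, it has injective trajectories of every length, which
   moreover can be chosen pairwise disjoint: c_t, ..., lambda^(2t)(c_t) for each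
   t. Functions supported on the midpoints lambda^t(c_t), and constant on the
   midpoints with t in a fixed class modulo m, form a subgroup F isomorphic to
   K^m for which the sums T_n(sigma, F) are direct, so that H(sigma, F) is
   m log|K|; thus the entropy is infinite. If lambda is bounded by N, then
   lambda^N = lambda^(N + N!). Finally, when every element of a finite subgroup
   F has a finite orbit, the increasing sequence T_n(sigma, F) is stationary. *)

Set Implicit Arguments.
Unset Strict Implicit.
Unset Printing Implicit Defensive.

Import Order.TTheory GRing.Theory Num.Theory.
Import numFieldNormedType.Exports.

Local Open Scope classical_set_scope.
Local Open Scope ring_scope.

(** * Orbits of a self-map: loops, periods and long injective trajectories *)

Section Orbits.
Variables (T : choiceType) (f : T -> T).

Lemma quasi_periodic_pt_looping (x : T) :
  quasi_periodic_pt f x -> exists n, looping f x n.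
Proof.
by case=> n [m [ltnm fnm]]; exists m; apply/trajectP; exists n.
Qed.

(** A forward orbit is totally preordered, so at most N points of it are distinct. *)
Lemma bounded_looping :
  bounded_map f -> exists N, forall x, looping f x N.
Proof.
case=> N bN; exists N => x; apply: contraT; rewrite -looping_uniq => ux.
have /bN oN : total_on [set iter k f x | k in [set: nat]] (le_iter f).
  move=> _ _ [k _ <-] [l _ <-]; case: (leqP k l) => [kl|/ltnW lk].
    by right; exists (l - k)%N; rewrite -iterD subnK.
  by left; exists (k - l)%N; rewrite -iterD subnK.
suff : (`I_N.+1 #<= `I_N)%card by rewrite card_le_II ltnn.
apply: card_le_trans oN.
have inj : {in `I_N.+1 &, injective (fun k => iter k f x)}.
  move=> i j; rewrite !inE /= => ilt jlt /eqP.
  rewrite -(nth_traject f ilt) -(nth_traject f jlt).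
  by rewrite nth_uniq ?size_traject// => /eqP.
rewrite -(card_le_eql (inj_card_eq inj)).
by apply: subset_card_le => _ [k _ <-]; exists k.
Qed.

(** A finite totally preordered set has a greatest element, and all its elements are iterates of
    that one, hence among the at most N points of its orbit. *)
Lemma looping_bounded N : (forall x, looping f x N) -> bounded_map f.
Proof.
move=> lN; exists N => I totI.
apply: contrapT => IN.
(* [I] may be infinite, so the argument runs on a list of more than N distinct points of it. *)
have [s [us sI sz]] : exists s : seq T,
    [/\ uniq s, {in s, forall x, I x} & (N < size s)%N].
  have [finI|infI] := pselect (finite_set I); last first.
    have [B BI NB] := infinite_set_fset N.+1 infI.
    by exists (enum_fset B); split=> // x xB; exact: BI.
  have [n In] := finI; exists (enum_fset (fset_set I)); split=> [//|x|].
    by rewrite -[_ \in _]/(x \in fset_set I) in_fset_set// inE.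
  have -> : size (enum_fset (fset_set I)) = n by exact: card_fset_set In.
  rewrite ltnNge; apply/negP => nN; apply: IN.
  by rewrite (card_le_eql In) card_le_II.
have [j js jmax] : exists2 j, j \in s & {in s, forall i, le_iter f i j}.
  have : s != [::] by case: (s) sz.
  elim: (s) sI => [//|a r ih] arI _.
  have aI : I a by apply: arI; rewrite mem_head.
  have [->|r0] := eqVneq r [::].
    by exists a; rewrite ?mem_head// => i; rewrite inE => /eqP->; exists 0%N.
  have [|//|j jr jmax] := ih.
    by move=> i ir; apply: arI; rewrite inE ir orbT.
  have jI : I j by apply: arI; rewrite inE jr orbT.
  have [aj|ja] := totI _ _ aI jI.
    exists j; first by rewrite inE jr orbT.
    by move=> i; rewrite inE => /predU1P[->//|]; exact: jmax.
  exists a; first by rewrite mem_head.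
  move=> i; rewrite inE => /predU1P[->|/jmax[k <-]]; first by exists 0%N.
  by case: ja => l <-; exists (k + l)%N; rewrite iterD.
have : {subset s <= traject f j N}.
  by move=> i /jmax[k <-]; apply: (loopingP (lN j)).
by move/(uniq_leq_size us); rewrite size_traject leqNgt sz.
Qed.

(** From index N on, each orbit is periodic with a period [N - k] between 1 and N, and N! is a
    common multiple of all of these. *)
Lemma looping_uniform N :
  (forall x, looping f x N) -> iter N f =1 iter (N + N`!) f.
Proof.
move=> lN x; have /trajectP[k kN fk] := lN x.
have per m : iter (N + m * (N - k)) f x = iter N f x.
  elim: m => [|m ih]; first by rewrite addn0.
  by rewrite mulSn addnCA iterD ih {1}fk -iterD (subnK (ltnW kN)).
have /dvdnP[m ->] : (N - k %| N`!)%N.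
  by apply: dvdn_fact; rewrite subn_gt0 kN leq_subr.
by rewrite per.
Qed.

Hypothesis unif : forall N, exists x, uniq (traject f x N).

(* Of two consecutive segments of an injective trajectory at most one contains
   a given point; induct on the points to avoid. *)
Lemma uniq_traject_avoiding (A : seq T) N :
  exists x, uniq (traject f x N) /\ ~~ has (mem A) (traject f x N).
Proof.
elim: A N => [|a A ih] N.
  by have [x ux] := unif N; exists x; split=> //; elim: traject.
have [x] := ih (N + N)%N; rewrite trajectD cat_uniq has_cat negb_or.
move=> [/and3P[u1 u12 u2] /andP[h1 h2]].
have hasU s : has (mem (a :: A)) s = (a \in s) || has (mem A) s.
  elim: s => //= b s ->; rewrite !inE (eq_sym a).
  by case: (b == a); case: (b \in A); case: (a \in s).
have [ain|aout] := boolP (a \in traject f x N).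
  exists (iter N f x); split=> //; rewrite hasU negb_or h2 andbT.
  by apply: contra u12 => a2; apply/hasP; exists a.
by exists x; split=> //; rewrite hasU negb_or aout.
Qed.

(** Greedy choice: each trajectory avoids the finitely many points, listed by [used], of all the
    preceding ones. *)
Lemma disjoint_trajects (L : nat -> nat) :
  exists c : nat -> T, (forall t, uniq (traject f (c t) (L t))) /\
    (forall s t, s != t ->
       ~~ has (mem (traject f (c s) (L s))) (traject f (c t) (L t))).
Proof.
have [g gP] := choice (fun p : seq T * nat =>
  uniq_traject_avoiding p.1 p.2).
pose used := fix used t := if t is t'.+1 then
  traject f (g (used t', L t')) (L t') ++ used t' else [::].
have usedS s t : (s < t)%N ->
    {subset traject f (g (used s, L s)) (L s) <= used t}.
  elim: t => // t ih; rewrite ltnS leq_eqVlt => /predU1P[->|/ih sub] x xs.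
    by rewrite /= mem_cat xs.
  by rewrite /= mem_cat sub ?orbT.
exists (fun t => g (used t, L t)); split=> [t|s t].
  by case: (gP (used t, L t)).
have main s' t' : (s' < t')%N ->
    ~~ has (mem (traject f (g (used s', L s')) (L s')))
      (traject f (g (used t', L t')) (L t')).
  move=> /usedS sub; have [_] := gP (used t', L t').
  by apply: contra => /hasP[x xt xs]; apply/hasP; exists x => //; exact: sub.
by rewrite neq_ltn => /orP[/main//|/main]; rewrite has_sym.
Qed.

End Orbits.

(** * Trajectories of finite subgroups and vanishing entropy *)

Section Trajectories.
Variables (G : zmodType) (phi : {additive G -> G}).

Lemma iter_additive n : {morph iter n phi : x y / x + y}.
Proof. by elim: n => // n ih x y; rewrite !iterS ih raddfD. Qed.

Lemma iter_additive0 n : iter n phi 0 = 0.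
Proof. by elim: n => // n ih; rewrite iterS ih raddf0. Qed.

Lemma big_set_sumP (A : nat -> set G) n y :
  (\big[@set_sum G/[set 0]]_(i < n) A i) y <->
  exists2 g : nat -> G, (forall i, (i < n)%N -> A i (g i)) &
    y = \sum_(i < n) g i.
Proof.
elim: n A y => [|n ih] A y.
  rewrite big_ord0; split=> [->|[g _ ->]]; last by rewrite big_ord0.
  by exists (fun=> 0); rewrite // big_ord0.
rewrite big_ord_recl; split.
  case=> a Aa [b /(ih (A \o succn))[g Ag ->] <-].
  exists (fun i => if i is i'.+1 then g i' else a).
    by case=> // i; rewrite ltnS => /Ag.
  by rewrite big_ord_recl.
case=> g Ag ->; rewrite big_ord_recl; exists (g 0%N); first exact: Ag.
exists (\sum_(i < n) g i.+1) => //; apply/(ih (A \o succn)).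
by exists (g \o succn) => // i ltin; exact: Ag.
Qed.

Lemma trajectoryP (F : set G) n y :
  trajectory phi F n y <->
  exists2 g : nat -> G, (forall i, (i < n)%N -> F (g i)) &
    y = \sum_(i < n) iter i phi (g i).
Proof.
have sumP z : trajectory phi F n z <-> _ :=
  big_set_sumP (fun i => iter i phi @` F) n z.
split=> [/sumP[g Ag ->]|[g Fg ->]]; last first.
  apply/sumP.
  by exists (fun i => iter i phi (g i)) => // i /Fg; exists (g i).
have /choice[h hP] i : exists x, (i < n)%N -> F x /\ iter i phi x = g i.
  have [/Ag[x Fx xE]|_] := boolP (i < n)%N; first by exists x.
  by exists 0.
exists h; first by move=> i /hP[].
by apply: eq_bigr => i _; case: (hP i).
Qed.

Variable F : set G.
Hypothesis finF : finite_subgroup F.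

Lemma finite_subgroup0 : F 0.
Proof. by case: finF => _ [/set_mem]. Qed.

Lemma finite_subgroupD x y : F x -> F y -> F (x + y).
Proof.
case: finF => _ [F0 FB] Fx Fy.
have FN z : F z -> F (- z).
  by move=> Fz; rewrite -[- z]add0r; apply/set_mem/FB => //; exact: mem_set.
rewrite -[y]opprK; apply/set_mem/FB; first exact: mem_set.
by apply/mem_set/FN.
Qed.

Lemma finite_trajectory n : finite_set (trajectory phi F n).
Proof.
rewrite /trajectory; apply: (big_ind (@finite_set G)) => [|A B|i _].
- exact: finite_set1.
- exact: finite_image2.
- by apply: finite_image; case: finF.
Qed.

Lemma trajectory0 n : trajectory phi F n 0.
Proof.
apply/trajectoryP; exists (fun=> 0) => [i _|]; first exact: finite_subgroup0.
by rewrite big1// => i _; rewrite iter_additive0.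
Qed.

Lemma trajectoryD n x y :
  trajectory phi F n x -> trajectory phi F n y -> trajectory phi F n (x + y).
Proof.
move=> /trajectoryP[g Fg ->] /trajectoryP[h Fh ->]; apply/trajectoryP.
exists (fun i => g i + h i) => [i ltin|].
  by apply: finite_subgroupD; [exact: Fg|exact: Fh].
by rewrite -big_split; apply: eq_bigr => i _; rewrite iter_additive.
Qed.

Lemma trajectory_iter n i x :
  (i < n)%N -> F x -> trajectory phi F n (iter i phi x).
Proof.
move=> ltin Fx; apply/trajectoryP.
exists (fun j => if j == i then x else 0).
  by move=> j _; case: ifP => // _; exact: finite_subgroup0.
rewrite (bigD1 (Ordinal ltin)) //= eqxx big1 ?addr0// => j ji.
by rewrite ifN ?iter_additive0.
Qed.

Hypothesis qpF : forall x, F x -> quasi_periodic_pt phi x.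

(** As [F] is finite, some N bounds the loop lengths of all its elements. Each iterate of an element
    of [F] is then one of its first N iterates, and T_N is closed under addition. *)
Lemma trajectory_stationary : exists N, forall n,
  trajectory phi F n `<=` trajectory phi F N.
Proof.
have /choice[p pP] x : exists n, F x -> looping phi x n.
  have [Fx|nFx] := pselect (F x); last by exists 0%N.
  by have [n] := quasi_periodic_pt_looping (qpF Fx); exists n.
have [/finite_seqP[s Fs] _] := finF; pose N := \max_(x <- s) p x.
exists N => n _ /trajectoryP[g Fg ->].
apply: (big_ind (trajectory phi F N)) => [||i _].
- exact: trajectory0.
- exact: trajectoryD.
have Fi := Fg _ (ltn_ord i).
have /loopingP/(_ i)/trajectP[k kp ->] := pP _ Fi.
apply: trajectory_iter => //; apply: leq_trans kp _.
by apply: leq_bigmax_seq => //; move: Fi; rewrite Fs.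
Qed.

Lemma quasi_periodic_entropy_wrt (R : realType) : entropy_wrt phi R F = 0.
Proof.
have [N TN] := trajectory_stationary.
pose c n := #|` fset_set (trajectory phi F n)|.
have c_gt0 n : (0 < c n)%N.
  rewrite cardfs_gt0; apply/fset0Pn; exists 0.
  by rewrite in_fset_set ?inE; [exact: trajectory0|exact: finite_trajectory].
have c_le n : (c n <= c N)%N.
  apply: fsubset_leq_card; rewrite -fset_set_sub//; exact: finite_trajectory.
apply: cvg_lim => //.
(* The sizes are at least 1 and at most |T_N|, so the quotients lie between 0 and log|T_N| / n. *)
apply: (@squeeze_cvgr _ _ _ _ (fun=> 0) (fun n => ln (c N)%:R * n%:R^-1)).
- near=> n; rewrite -/(c n); apply/andP; split.
    by rewrite mulr_ge0 ?invr_ge0// ln_ge0// ler1n.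
  by rewrite ler_wpM2r ?invr_ge0// ler_ln ?posrE ?ltr0n// ler_nat.
- exact: cvg_cst.
- rewrite -[X in _ --> X](mulr0 (ln (c N)%:R)); apply: cvgMl_tmp.
  apply/gtr0_cvgV0; last exact: cvgr_idn.
  by near=> n; rewrite ltr0n; near: n; exists 1%N.
Unshelve. all: by end_near. Qed.

End Trajectories.

Lemma finite_subgroup_set0 (G : zmodType) : finite_subgroup ([set 0] : set G).
Proof.
split; first exact: finite_set1.
by split=> [|x y]; rewrite ?inE//= => -> ->; rewrite subr0.
Qed.

Lemma locally_quasi_periodic_ent (R : realType) (G : zmodType)
    (phi : {additive G -> G}) : locally_quasi_periodic phi -> ent phi R = 0%E.
Proof.
move=> qp.
suff E :
    [set (entropy_wrt phi R F)%:E | F in @finite_subgroup G] = [set 0%E].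
  by rewrite /ent E ereal_sup1.
apply/seteqP; split=> [_ [F finF <-]|_ ->] /=.
  by rewrite quasi_periodic_entropy_wrt.
(* The zero subgroup makes the set of values nonempty; the supremum of the empty set would be
   -oo. *)
exists [set 0]; first exact: finite_subgroup_set0.
by rewrite quasi_periodic_entropy_wrt//; exact: finite_subgroup_set0.
Qed.

Lemma card_fset_set_range (A : finType) (B : choiceType) (h : A -> B) :
  injective h -> #|` fset_set (range h)| = #|A|.
Proof.
move=> h_inj; apply: card_fset_set.
apply: card_eq_trans (inj_card_eq (in2W h_inj)) _.
rewrite card_eq_sym; apply: card_eq_trans card_II _.
rewrite -(_ : range (@enum_rank A) = [set: 'I_#|A|]).
  exact: inj_card_eq (in2W (@enum_rank_inj A)).
by apply/seteqP; split=> // i _; exists (enum_val i); rewrite ?enum_valK.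
Qed.

Lemma iter_gshift (T : Type) (f : T -> T) (K : zmodType) n (x : T -> K) i :
  iter n (gshift f (K:=K)) x i = x (iter n f i).
Proof. by elim: n x i => // n ih x i; rewrite iterS /gshift ih -iterSr. Qed.

(** * Infinite entropy from arbitrarily long injective trajectories *)

Section Unbounded.
Variables (T : choiceType) (f : T -> T).
Hypothesis unif : forall N, exists x, uniq (traject f x N).

(** [e] labels the midpoint of the t-th of the disjoint trajectories by t. The t unmarked points on
    either side of it will keep apart the shifts of a function supported on the midpoints. *)
Lemma separated_marking : exists (e : T -> option nat) (c : nat -> T),
  forall t s, (s <= t.*2)%N ->
    e (iter s f (c t)) = if s == t then Some t else None.
Proof.
have [c [uc dc]] := disjoint_trajects unif (fun t => t.*2.+1).
have in_tr s t : (s <= t.*2)%N -> iter s f (c t) \in traject f (c t) t.*2.+1.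
  by move=> st; apply/trajectP; exists s.
(* Disjointness of the trajectories gives [t' = t], then injectivity of the t-th one gives
   [s = t]. *)
have center s t t' : (s <= t.*2)%N ->
    iter t' f (c t') = iter s f (c t) -> t' = t /\ s = t.
  move=> st E; have t't : t' = t.
    apply/eqP/negP => /negP/dc/hasP; apply; exists (iter s f (c t)).
      exact: in_tr.
    by rewrite -E; apply: in_tr; rewrite -addnn leq_addr.
  split=> //; move: E; rewrite t't => /eqP.
  have tt : (t < t.*2.+1)%N by rewrite ltnS -addnn leq_addr.
  rewrite -(nth_traject f tt) -(nth_traject f (st : (s < t.*2.+1)%N)).
  by rewrite nth_uniq ?size_traject// => /eqP.
have /choice[e eP] x : exists o : option nat,
    if o is Some t then iter t f (c t) = x else forall t, iter t f (c t) <> x.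
  have [[t tx]|nx] := pselect (exists t, iter t f (c t) = x).
    by exists (Some t).
  by exists None => t tx; apply: nx; exists t.
exists e, c => t s st; have := eP (iter s f (c t)).
case: (e _) => [t' /(center _ _ _ st)[-> ->]|none]; first by rewrite eqxx.
by case: eqP => // sE; case: (none t); rewrite sE.
Qed.

Variable K : finZmodType.

(** [Phi n] maps W^n bijectively onto T_n, so that |T_n| = |K|^(n(M+1)) and log|T_n| / n is constant
    for positive n. *)
Lemma exists_entropy_wrt (R : realType) (M : nat) :
  exists2 F : set (T -> K), finite_subgroup F &
    entropy_wrt (gshift f (K:=K)) R F = ln #|K|%:R *+ M.+1.
Proof.
have [e [c ec]] := separated_marking.
pose W := {ffun 'I_M.+1 -> K}.
pose spread (w : W) (i : T) : K :=
  if e i is Some t then w (inord (t %% M.+1)) else 0.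
pose F := range spread.
have finF : finite_subgroup F.
  split; first exact/finite_image/finite_finset.
  split=> [|x y /set_mem[w _ <-] /set_mem[w' _ <-]]; apply/mem_set.
    exists 0 => //; apply/funext => i; rewrite /spread.
    by case: (e i) => // t; rewrite ffunE.
  exists (w - w') => //; apply/funext => i; rewrite /spread.
  rewrite -[RHS]/(spread w i - spread w' i) /spread.
  by case: (e i) => [t|]; rewrite ?subr0// !ffunE.
pose Phi n (h : {ffun 'I_n -> W}) : T -> K :=
  \sum_(i < n) iter i (gshift f (K:=K)) (spread (h i)).
have Phi_inj n : injective (@Phi n).
  move=> h h' hh'.
  (* Coordinate m of the k-th component can be read off at a single point. The index [t] is
     congruent to m modulo M+1 and at least n, so the l-th summand looks at position t - k + l,
     which is at most 2t; this is the midpoint only for l = k. *)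
  have PhiE (g : {ffun 'I_n -> W}) (k : 'I_n) (m : 'I_M.+1) :
      let t := (n * M.+1 + m)%N in
      Phi n g (iter (t - k) f (c t)) = g k m.
    move=> t.
    have nt : (n <= t)%N.
      by rewrite (leq_trans (leq_pmulr n (ltn0Sn M)))// leq_addr.
    have kt : (k <= t)%N by rewrite (leq_trans _ nt)// ltnW.
    rewrite /Phi fct_sumE (bigD1 k)//= big1 ?addr0 => [|l lk].
      rewrite iter_gshift -iterD subnKC// /spread ec ?eqxx -?addnn ?leq_addr//.
      by rewrite /t modnMDl modn_small// inord_val.
    rewrite iter_gshift -iterD /spread ec ?ifN//.
      by apply: contra lk => /eqP lk; apply/eqP/val_inj; move: lk kt => /=; lia.
    by have := ltn_ord l; lia.
  apply/ffunP => k; apply/ffunP => m.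
  by rewrite -!PhiE hh'.
have trajE n : trajectory (gshift f (K:=K)) F n = range (@Phi n).
  apply/seteqP; split=> [y /trajectoryP[g Fg ->]|_ [h _ <-]].
    have /choice[w wP] (i : 'I_n) : exists w, spread w = g i.
      by have [w _ wE] := Fg _ (ltn_ord i); exists w.
    exists (finfun w) => //; rewrite /Phi; apply: eq_bigr => i _.
    by rewrite ffunE wP.
  apply/trajectoryP.
  (* [h] is extended by 0 beyond n; the sum does not see these values. *)
  exists (fun i => spread (odflt 0 (omap h (insub i)))) => [i _|].
    by eexists.
  by apply: eq_bigr => i _; rewrite valK.
exists F => //; apply: lim_near_cst; first exact: norm_hausdorff.
near=> n.
have n0 : n%:R != 0 :> R by rewrite pnatr_eq0 -lt0n; near: n; exists 1%N.
have K0 : 0 < #|K|%:R :> R by rewrite ltr0n; apply/card_gt0P; exists 0.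
rewrite trajE card_fset_set_range; last exact: Phi_inj.
rewrite !card_ffun !card_ord !natrX !lnXn ?exprn_gt0//.
by rewrite -[X in X / _]mulr_natr mulfK.
Unshelve. all: by end_near. Qed.

Lemma unbounded_ent (R : realType) :
  (1 < #|K|)%N -> ent (gshift f (K:=K)) R = +oo%E.
Proof.
move=> K1; have lnK : 0 < ln (#|K|%:R : R) by rewrite ln_gt0// ltr1n.
apply/eqyP => r _.
(* By the Archimedean property, (M+1) log|K| exceeds the given [r]. *)
pose M := Num.bound (r / ln (#|K|%:R : R)).
have [F finF FE] := exists_entropy_wrt R M.
apply: (@le_trans _ _ (entropy_wrt (gshift f (K:=K)) R F)%:E); last first.
  by apply: ereal_sup_ubound; exists F.
rewrite lee_fin FE -[ln _ *+ _]mulr_natl -ler_pdivrMr//.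
by rewrite ltW// (lt_le_trans (unstable.ltr_bound _))// ler_nat.
Qed.

End Unbounded.

Theorem theorem1p3 (R : realType) (Gamma : Type) (lambda : Gamma -> Gamma)
    (K : finZmodType) (K_nontrivial : (1 < #|K|)%N) :
  [<-> ent (gshift lambda (K:=K)) R = 0%E;
       ent (gshift lambda (K:=K)) R \is a fin_num;
       bounded_map lambda;
       quasi_periodic (gshift lambda (K:=K));
       locally_quasi_periodic (gshift lambda (K:=K))].
Proof.
(* [{classic Gamma}] carries the equality and choice structures that [traject] and [uniq] arguments
   rely on. *)
pose f : {classic Gamma} -> {classic Gamma} := lambda.
tfae.
- by move=> ->.
- move=> fin; apply: contrapT => nb.
  suff unif : forall N, exists x, uniq (traject f x N).
    by move: fin; rewrite (unbounded_ent unif R K_nontrivial).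
  (* If no trajectory of N points is injective, neither is any of N+1 points, so every point loops
     within N steps. *)
  move=> N; apply: contrapT => nu; apply: nb.
  apply: (@looping_bounded _ f N) => x; apply: contrapT => /negP.
  rewrite -looping_uniq trajectSr rcons_uniq => /andP[_ ux].
  by apply: nu; exists x.
- case/(@bounded_looping _ f) => N /looping_uniform perN.
  exists N, (N + N`!)%N; split.
    by rewrite -[X in (X < _)%N]addn0 ltn_add2l fact_gt0.
  by apply/funext => x; apply/funext => i; rewrite !iter_gshift (perN i).
- by case=> n [m [nm E]] x; exists n, m; rewrite E.
- exact: locally_quasi_periodic_ent.
Qed.
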